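(* For any two cylindric partitions $\alpha,\beta$ on $\mathcal C_{k,n}$ and variable sets $\mathbf x=(x_a)_{a\in A}$, $\mathbf y=(y_a)_{a\in A}$, \[ \sum_{\substack{\mu\in\operatorname{Cylpar};\\ \mu\subseteq\alpha;\ \mu\subseteq\beta}} s_{\alpha/\mu}(\mathbf x)\,s_{\beta/\mu}(\mathbf y)=\sum_{\substack{\lambda\in\operatorname{Cylpar};\\ \alpha\subseteq\lambda;\ \beta\subseteq\lambda}} s_{\lambda/\beta}(\mathbf x)\,s_{\lambda/\alpha}(\mathbf y). \]
   Context: Fix integers $n>k\ge 1$. A cylindric partition is a weakly decreasing sequence $(\lambda_m)_{m\in\mathbb Z}$ of integers with $\lambda_m=\lambda_{m+k}+n-k$ for all $m$; $\operatorname{Cylpar}$ is the set of cylindric partitions. A point $(x,y)\in\mathbb Z^2$ lies in $\lambda$ if $y\le\lambda_x$. A box is an equivalence class of points modulo translation by integer multiples of $(-k,n-k)$; $\pi$ is the projection; a box lies in $\lambda$ iff its representatives do. $\mu\subseteq\lambda$ means $\mu_m\le\lambda_m$ for all $m$; the boxes of $\lambda/\mu$ are the (finitely many) boxes in $\lambda$ not in $\mu$. Fix a totally ordered alphabet $A$. A semistandard cylindric tableau of shape $\lambda/\mu$ is a map $R$ from the boxes of $\lambda/\mu$ to $A$ such that $R(\pi(x,y_1))\le R(\pi(x,y_2))$ whenever the points $(x,y_1),(x,y_2)$ lie in $\lambda$ but not in $\mu$ and $y_1<y_2$, and $R(\pi(x_1,y))<R(\pi(x_2,y))$ whenever $(x_1,y),(x_2,y)$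 lie in $\lambda$ but not $\mu$ and $x_1<x_2$. $\operatorname{SSCT}(\lambda/\mu)$ is the set of these. For a variable set $\mathbf x=(x_a)_{a\in A}$ (distinct commuting indeterminates), $\mathbf x^{\operatorname{wt}(R)}=\prod_{B}x_{R(B)}$ over the boxes $B$ of $\lambda/\mu$, and the cylindric Schur function is $s_{\lambda/\mu}(\mathbf x)=\sum_{R\in\operatorname{SSCT}(\lambda/\mu)}\mathbf x^{\operatorname{wt}(R)}$. The identity is an identity of formal power series in $\mathbf x,\mathbf y$. *)

(* Defs.v *)
From HB Require Import structures.
From mathcomp Require Import all_boot all_order all_algebra.
From mathcomp Require Import boolp classical_sets reals constructive_ereal ereal esum.

Set Implicit Arguments.
Unset Strict Implicit.
Unset Printing Implicit Defensive.

Import Order.TTheory GRing.Theory Num.Theory.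
Local Open Scope ring_scope.

Definition cylpar (n k : nat) (lam : int -> int) : Prop :=
  (forall m m' : int, m <= m' -> lam m' <= lam m) /\
  (forall m : int, lam m = lam (m + k%:Z) + (n%:Z - k%:Z)).

Definition subpar (mu lam : int -> int) : Prop := forall m : int, mu m <= lam m.

Definition in_skew (lam mu : int -> int) (x y : int) : bool :=
  (y <= lam x) && ~~ (y <= mu x).

(* A map from the boxes of lam/mu to A is encoded as a map R on points of   *)
(* Z^2 that is invariant under the translation by (-k, n-k) (so it is a     *)
(* function of the box pi(x,y)), which is defined (Some _) exactly on the   *)
(* points of lam/mu and undefined (None) elsewhere.  Distinct such R        *)
(* correspond bijectively to distinct maps from the boxes of lam/mu to A.   *)
Section Tableaux.
Context {d : Order.disp_t} {A : orderType d}.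

Definition is_ssct (n k : nat) (lam mu : int -> int) (R : int -> int -> option A)
  : Prop :=
  (forall x y : int, R x y = R (x - k%:Z) (y + (n%:Z - k%:Z))) /\
  (forall x y : int, isSome (R x y) = in_skew lam mu x y) /\
  (forall (x y1 y2 : int) (a b : A),
      y1 < y2 -> R x y1 = Some a -> R x y2 = Some b -> (a <= b)%O) /\
  (forall (x1 x2 y : int) (a b : A),
      x1 < x2 -> R x1 y = Some a -> R x2 y = Some b -> (a < b)%O).

(* wt(R) a = number of boxes B of lam/mu with R(B) = a; every box has a      *)
(* unique representative (x,y) with 0 <= x < k, and mu x < y <= lam x.       *)
Definition wt (k : nat) (lam mu : int -> int) (R : int -> int -> option A) (a : A)
  : nat :=
  \sum_(i < k) \sum_(t < absz (lam i%:Z - mu i%:Z))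
     nat_of_bool (R i%:Z (mu i%:Z + 1 + t%:Z)%R == Some a).

(* Coefficient of the monomial x^p (p : A -> nat an exponent vector) in the  *)
(* cylindric skew Schur function s_{lam/mu}(x): the number of R in          *)
(* SSCT(lam/mu) with x^{wt(R)} = x^p.                                       *)
Definition scoef (RR : realType) (n k : nat) (lam mu : int -> int) (p : A -> nat)
  : \bar RR :=
  \esum_(R in [set R : int -> int -> option A |
               is_ssct n k lam mu R /\ (forall a, wt k lam mu R a = p a)]) 1%E.

End Tableaux.

(* Main.v *)
(** Let [U_m] be the 0/1 matrix on cylindric partitions whose (mu, lam) entry
    says that lam/mu is a horizontal strip with [m] boxes per period, and let
    [D_m] be its transpose.  Peeling off the least letter of a tableau writes
    the coefficient of [x^p] in [s_{lam/mu}] as an entry of the product of the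
    [U_(p a)], the letters [a] of the support of [p] in increasing order.  So
    the two sides of the identity are entries of a product of [D]'s and a
    product of [U]'s, multiplied in either order, and it suffices that [D_a]
    and [U_b] commute.  This is the local rule
    lam_x + mu_(x-1) = min(alpha_(x-1), beta_(x-1)) + max(alpha_x, beta_x):
    it exchanges the partitions mu below alpha and beta with the partitions lam
    above them; no Cauchy factor appears, since on the cylinder this bijection
    has no exceptional first row.  All sums are finite because the columns of
    [U_m] have finite support. *)

Require Import Defs.
From HB Require Import structures.
From mathcomp Require Import all_boot all_order all_algebra.
From mathcomp Require Import boolp classical_sets functions cardinality fsbigop.
From mathcomp Require Import reals constructive_ereal ereal esum.
From mathcomp Require Import zify.

Set Implicit Arguments.
Unset Strict Implicit.
Unset Printing Implicit Defensive.

Import Order.TTheory GRing.Theory Num.Theory.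
Local Open Scope ring_scope.
Local Open Scope classical_set_scope.

(** * Nonnegative infinite sums and matrices *)

Section EsumComplements.
Context {R : realType}.
Local Open Scope ereal_scope.

(** Finite partial sums give one inequality. A finite positive [c] can be divided out for the
    converse; [c = 0] and [c = +oo] are treated apart. *)
Lemma ge0_esumZl (T : choiceType) (I : set T) (f : T -> \bar R) (c : \bar R) :
  0 <= c -> (forall i, 0 <= f i) ->
  \esum_(i in I) (c * f i) = c * \esum_(i in I) f i.
Proof.
move=> c0 f0; apply/eqP; rewrite eq_le; apply/andP; split.
  apply: ge_ereal_sup => _ [X [finX XI] <-].
  rewrite -ge0_mule_fsumr// lee_wpmul2l//.
  by apply: esum_ge; exists X.
case: c c0 => [c|_|//].
  move=> c0; have [->|cN0] := eqVneq c 0%R.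
    by rewrite mul0e; apply: esum_ge0 => i _; rewrite mul0e.
  have {c0 cN0}c0 : (0 < c)%R by rewrite lt_def cN0 -lee_fin.
  rewrite -lee_pdivlMl//; apply: ge_ereal_sup => _ [X [finX XI] <-].
  rewrite lee_pdivlMl// ge0_mule_fsumr//.
  by apply: esum_ge; exists X.
(* Here [c] is [+oo]: a single nonzero term already makes the left-hand sum infinite. *)
have [fI|] := pselect (forall i, I i -> f i = 0).
  by rewrite esum1 // mule0 esum_ge0// => i _; rewrite mule_ge0.
move=> /existsNP[i /not_implyP[Ii /eqP fi]].
apply: (@le_trans _ _ +oo); first by rewrite leey.
rewrite (esumID [set i]); last by move=> j _; rewrite mule_ge0.
rewrite (_ : I `&` [set i] = [set i]); last by rewrite setIidr// => j ->.
rewrite esum_set1 ?mule_ge0// gt0_mulye; last by rewrite lt0e fi f0.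
by rewrite leeDl// esum_ge0// => j _; rewrite mule_ge0.
Qed.

Lemma exchange_esum (T1 T2 : choiceType) (I : set T1) (J : set T2)
    (f : T1 -> T2 -> \bar R) : (forall i j, 0 <= f i j) ->
  \esum_(i in I) \esum_(j in J) f i j = \esum_(j in J) \esum_(i in I) f i j.
Proof.
move=> f0; rewrite !esum_esum//.
rewrite (reindex_esum (J `*`` fun=> I) _ (fun x => (x.2, x.1)))//; split=> //=.
- by move=> [i j] [/= Ji Ij].
- by move=> [i j] [i' j'] _ _ /= [-> ->].
- by move=> [i j] [/= Ii Jj]; exists (j, i).
Qed.

Lemma esum_fin_num (T : choiceType) (I : set T) (f : T -> \bar R) :
  (forall i, 0 <= f i) -> finite_set (I `&` [set i | f i != 0]) ->
  (forall i, I i -> f i \is a fin_num) -> \esum_(i in I) f i \is a fin_num.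
Proof.
move=> f0 finf ffin.
have -> : \esum_(i in I) f i = \esum_(i in I `&` [set i | f i != 0]) f i.
  rewrite esum_mkcondr; apply: eq_esum => i _; case: ifPn => //.
  by rewrite notin_setE /= => /negP; rewrite negbK => /eqP.
rewrite esum_fset// fsbig_finite//= big_seq_cond.
apply: (big_ind (fun x => x \is a fin_num)) => // [x y fx fy|i].
  by rewrite fin_numD fx.
by rewrite andbT in_fset_set// in_setE => -[/ffin].
Qed.

End EsumComplements.

(* Matrices over the extended reals with rows and columns indexed by C; the
   values outside of C are irrelevant. *)
Section Kernels.
Context {R : realType} {T : choiceType} (C : set T).
Local Open Scope ereal_scope.
Implicit Types M N P : T -> T -> \bar R.

Definition kmul M N : T -> T -> \bar R :=
  fun a c => \esum_(b in C) (M a b * N b c).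

Definition kdelta : T -> T -> \bar R := fun a b => if a == b then 1 else 0.

Definition ktr M : T -> T -> \bar R := fun a b => M b a.

Definition kge0 M := forall a b, 0 <= M a b.

Definition kcomm M N :=
  forall a b, C a -> C b -> kmul M N a b = kmul N M a b.

Lemma kmul_ge0 M N : kge0 M -> kge0 N -> kge0 (kmul M N).
Proof. by move=> M0 N0 a b; apply: esum_ge0 => c _; rewrite mule_ge0. Qed.

Lemma kdelta_ge0 : kge0 kdelta.
Proof. by move=> a b; rewrite /kdelta; case: ifP. Qed.

(** Nonnegativity allows the two summations to be exchanged with no convergence condition, so
    entries may be infinite here. *)
Lemma kmulA M N P a b : kge0 M -> kge0 N -> kge0 P ->
  kmul M (kmul N P) a b = kmul (kmul M N) P a b.
Proof.
move=> M0 N0 P0; rewrite /kmul.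
transitivity (\esum_(d in C) \esum_(c in C) (M a d * (N d c * P c b))).
  by apply: eq_esum => d _; rewrite ge0_esumZl// => c; rewrite mule_ge0.
rewrite exchange_esum; last by move=> c d; rewrite mule_ge0// mule_ge0.
apply: eq_esum => c _.
rewrite muleC -ge0_esumZl//; last by move=> *; rewrite mule_ge0.
by apply: eq_esum => d _; rewrite [RHS]muleC muleA.
Qed.

Lemma kmul1 M a b : kge0 M -> C b -> kmul M kdelta a b = M a b.
Proof.
move=> M0 Cb; rewrite /kmul (esumID [set b]); last first.
  by move=> c _; rewrite mule_ge0 ?kdelta_ge0.
rewrite (_ : C `&` [set b] = [set b]); last by rewrite setIidr// => j ->.
rewrite esum_set1 ?mule_ge0 ?kdelta_ge0// esum1 ?adde0 /kdelta ?eqxx ?mule1//.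
by move=> c [_ /= /eqP/negbTE ->]; rewrite mule0.
Qed.

Lemma ktr_mul M N : ktr (kmul M N) = kmul (ktr N) (ktr M).
Proof.
by apply/funext => a; apply/funext => b; apply: eq_esum => c _; rewrite muleC.
Qed.

Lemma ktr_delta : ktr kdelta = kdelta.
Proof.
by apply/funext => a; apply/funext => b; rewrite /ktr /kdelta eq_sym.
Qed.

Lemma kcommC M N : kcomm M N -> kcomm N M.
Proof. by move=> MN a b Ca Cb; rewrite MN. Qed.

Lemma kcomm_tr M N : kcomm M N -> kcomm (ktr M) (ktr N).
Proof.
by move=> MN a b Ca Cb; rewrite -(ktr_mul N M) -(ktr_mul M N); apply/esym/MN.
Qed.

Lemma kcomm_delta M : kge0 M -> kcomm M kdelta.
Proof.
move=> M0 a b Ca Cb; rewrite kmul1//.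
(* The left unit law is the transpose of the right unit law. *)
have -> : kmul kdelta M = ktr (kmul (ktr M) kdelta).
  by rewrite ktr_mul ktr_delta.
by rewrite {1}/ktr kmul1// => x y; apply: M0.
Qed.

Lemma kcommM M N P : kge0 M -> kge0 N -> kge0 P ->
  kcomm M N -> kcomm M P -> kcomm M (kmul N P).
Proof.
move=> M0 N0 P0 MN MP a b Ca Cb.
rewrite kmulA// -[RHS]kmulA//.
transitivity (kmul (kmul N M) P a b).
  by apply: eq_esum => c Cc; rewrite MN.
by rewrite -kmulA//; apply: eq_esum => c Cc; rewrite MP.
Qed.

(** This finiteness is stable under products and suffices for the entries of [kmul (ktr M) N] to be
    finite numbers. *)
Definition colfin M := forall b, C b ->
  finite_set (C `&` [set a | M a b != 0]) /\
  forall a, C a -> M a b \is a fin_num.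

Lemma colfin_delta : colfin kdelta.
Proof.
move=> b Cb; split; last by move=> a Ca; rewrite /kdelta; case: ifP.
apply: (@sub_finite_set _ _ [set b]) => // a [_ /=].
by rewrite /kdelta; case: (eqVneq a b) => // _; rewrite eqxx.
Qed.

(** The support of column [b] of the product lies in the union of the supports of the columns [c] of
    [M], for [c] in the finite support of column [b] of [N]. *)
Lemma colfin_mul M N : kge0 M -> kge0 N ->
  colfin M -> colfin N -> colfin (kmul M N).
Proof.
move=> M0 N0 Mf Nf b Cb; have [Nb1 Nb2] := Nf _ Cb; split.
  apply: (@sub_finite_set _ _ (\bigcup_(c in C `&` [set c | N c b != 0])
    (C `&` [set a | M a c != 0]))).
    move=> a [Ca /= /eqP MNab]; apply: contrapT => H; apply: MNab.
    apply: esum1 => c Cc.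
    have [->|Nc] := eqVneq (N c b) 0; first by rewrite mule0.
    have [->|Mc] := eqVneq (M a c) 0; first by rewrite mul0e.
    by exfalso; apply: H; exists c.
  apply: bigcup_finite => // c [Cc _].
  by have [] := Mf _ Cc.
move=> a Ca; apply: esum_fin_num.
- by move=> c; rewrite mule_ge0.
- apply: (sub_finite_set _ Nb1) => c [Cc /= MN]; split => //=.
  by apply: contra MN => /eqP ->; rewrite mule0.
- by move=> c Cc; rewrite fin_numM ?Nb2//; have [_ ->] := Mf _ Cc.
Qed.

Lemma kmul_tr_fin M N a b : kge0 M -> kge0 N -> colfin M -> colfin N ->
  C a -> C b -> kmul (ktr M) N a b \is a fin_num.
Proof.
move=> M0 N0 Mf Nf Ca Cb; have [Na1 Na2] := Nf _ Cb.
apply: esum_fin_num.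
- by move=> c; rewrite mule_ge0// M0.
- apply: (sub_finite_set _ Na1) => c [Cc /= MN]; split => //=.
  by apply: contra MN => /eqP ->; rewrite mule0.
- by move=> c Cc; rewrite fin_numM ?Na2//; have [_ ->] := Mf _ Ca.
Qed.

(** * Products of a family of matrices *)

Context {I : Type} (U : I -> T -> T -> \bar R).
Hypothesis U0 : forall i, kge0 (U i).

Definition kprod (s : seq I) := foldr (fun i M => kmul (U i) M) kdelta s.

Lemma kprod_ge0 s : kge0 (kprod s).
Proof.
elim: s => [|i s IH] /=; [exact: kdelta_ge0|exact: kmul_ge0].
Qed.

Lemma kcomm_prod M s : kge0 M -> (forall i, kcomm M (U i)) ->
  kcomm M (kprod s).
Proof.
move=> M0 MU; elim: s => [|i s IH] /=; first exact: kcomm_delta.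
by apply: kcommM => //; exact: kprod_ge0.
Qed.

Lemma kcomm_prod_tr s t : (forall i j, kcomm (ktr (U i)) (U j)) ->
  kcomm (ktr (kprod s)) (kprod t).
Proof.
move=> UU; apply: kcomm_prod => [a b|j]; first exact: kprod_ge0.
(* Writing [U j] as a double transpose reduces the goal to [kprod s] commuting with [ktr (U j)], to
   which [kcomm_prod] applies a second time. *)
have -> : U j = ktr (ktr (U j)) by [].
apply/kcomm_tr/kcommC/kcomm_prod => [a b|i]; first exact: U0.
by have /kcomm_tr/kcommC := UU i j.
Qed.

Lemma colfin_prod s : (forall i, colfin (U i)) -> colfin (kprod s).
Proof.
move=> Uf; elim: s => [|i s IH] /=; first exact: colfin_delta.
by apply: colfin_mul => //; exact: kprod_ge0.
Qed.

End Kernels.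

(** * Horizontal strips and the local rule *)

Section HorizontalStrips.
Context {n k : nat} (k_gt0 : (0 < k)%N).

Definition cylpars : set (int -> int) := [set lam | cylpar n k lam].

(** The second condition says that no two boxes share a [y]-coordinate; the sum over one period
    counts boxes modulo translation. *)
Definition hstrip (m : nat) (mu lam : int -> int) : Prop :=
  [/\ subpar mu lam, forall x : int, lam (x + 1) <= mu x &
      \sum_(i < k) (lam i%:Z - mu i%:Z) = m%:Z].

Lemma cylpar_shift lam x j : cylpar n k lam ->
  lam (x + j * k%:Z) = lam x - j * (n%:Z - k%:Z).
Proof.
move=> [_ lamP].
have step i : lam (x + (i + 1) * k%:Z) = lam (x + i * k%:Z) - (n%:Z - k%:Z).
  rewrite (lamP (x + i * k%:Z)) addrK; congr lam.
  by rewrite mulrDl mul1r addrA.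
elim: j => [|j IH|j IH]; first by rewrite !mul0r addr0 subr0.
  by rewrite -addn1 PoszD step IH; lia.
have := step (- (j.+1)%:Z); rewrite (_ : - (j.+1)%:Z + 1 = - j%:Z); last by lia.
by rewrite IH; lia.
Qed.

Lemma in_skew_shift lam mu x y : cylpar n k lam -> cylpar n k mu ->
  in_skew lam mu (x - k%:Z) (y + (n%:Z - k%:Z)) = in_skew lam mu x y.
Proof.
move=> [_ lamP] [_ muP]; rewrite /in_skew.
by have := lamP (x - k%:Z); have := muP (x - k%:Z); rewrite !subrK; lia.
Qed.

Lemma ltz_modk (x : int) : 0 <= (x %% k)%Z < k%:Z.
Proof.
have k0 : k%:Z != 0 by lia.
by rewrite modz_ge0//= ltz_mod.
Qed.

Lemma cylpar_mod lam x : cylpar n k lam ->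
  lam x = lam (x %% k)%Z - (x %/ k)%Z * (n%:Z - k%:Z).
Proof.
by move=> lamP; rewrite {1}(divz_eq x k) addrC cylpar_shift.
Qed.

(** The two sums differ only in one end term, and the hypothesis identifies these. *)
Lemma sum_pred_shift (g : int -> int) : g (-1) = g (k%:Z - 1) ->
  \sum_(i < k) g (i%:Z - 1) = \sum_(i < k) g i%:Z.
Proof.
case: k k_gt0 => // k' _ gk; rewrite big_ord_recl big_ord_recr /= [LHS]addrC.
congr (_ + _); last by transitivity (g (-1)); [congr g|rewrite gk; congr g; lia].
by apply: eq_bigr => i _; congr g; rewrite /bump /=; lia.
Qed.

Lemma sum_succ_shift (g : int -> int) : g 0 = g k%:Z ->
  \sum_(i < k) g (i%:Z + 1) = \sum_(i < k) g i%:Z.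
Proof.
move=> gk; rewrite -(@sum_pred_shift (fun x => g (x + 1))).
  by apply: eq_bigr => i _; congr g; lia.
by rewrite subrK addNr.
Qed.

(** For strips, [mu (x - 1)] and the new value at [x] range over the same interval, from the maximum
    of [al x] and [be x] to the minimum of [al (x - 1)] and [be (x - 1)]. The rule reflects this
    interval. *)
Definition toggle_up (al be mu : int -> int) (x : int) : int :=
  Num.min (al (x - 1)) (be (x - 1)) + Num.max (al x) (be x) - mu (x - 1).

Definition toggle_down (al be lam : int -> int) (x : int) : int :=
  Num.min (al x) (be x) + Num.max (al (x + 1)) (be (x + 1)) - lam (x + 1).

Lemma toggle_upK al be : cancel (toggle_up al be) (toggle_down al be).
Proof.
move=> mu; apply/funext => x; rewrite /toggle_up /toggle_down !addrK.
by lia.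
Qed.

Lemma toggle_downK al be : cancel (toggle_down al be) (toggle_up al be).
Proof.
move=> mu; apply/funext => x; rewrite /toggle_up /toggle_down !subrK.
by lia.
Qed.

Section Toggle.
Context {al be : int -> int} (alP : cylpars al) (beP : cylpars be).

(** For [x < y] the value at [y] is at most the minimum of [al] and [be] at [y - 1], and the value
    at [x] is at least their maximum at [x]; since [x <= y - 1], monotonicity of [al] compares the
    two. *)
Lemma toggle_up_cylpar mu : cylpars mu ->
  subpar mu al -> subpar mu be ->
  (forall x : int, al (x + 1) <= mu x) -> (forall x : int, be (x + 1) <= mu x) ->
  cylpars (toggle_up al be mu).
Proof.
move=> [_ muk] mual mube almu bemu; case: alP beP => [ald alk] [bed bek].
split=> x; last first.
  have := muk (x - 1); have := alk (x - 1); have := bek (x - 1).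
  have := alk x; have := bek x.
  by rewrite /toggle_up (_ : x - 1 + k%:Z = x + k%:Z - 1); lia.
move=> y; rewrite le_eqVlt => /predU1P[->//|xy]; rewrite /toggle_up.
have := mual (x - 1); have := mube (x - 1).
have := almu (y - 1); have := bemu (y - 1).
have := ald x (y - 1); have := bed x (y - 1).
by rewrite !subrK; lia.
Qed.

Lemma toggle_down_cylpar lam : cylpars lam ->
  subpar al lam -> subpar be lam ->
  (forall x : int, lam (x + 1) <= al x) -> (forall x : int, lam (x + 1) <= be x) ->
  cylpars (toggle_down al be lam).
Proof.
move=> [_ muk] mual mube almu bemu; case: alP beP => [ald alk] [bed bek].
split=> x; last first.
  have := muk (x + 1); have := alk (x + 1); have := bek (x + 1).
  have := alk x; have := bek x.
  by rewrite /toggle_down (_ : x + 1 + k%:Z = x + k%:Z + 1); lia.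
move=> y; rewrite le_eqVlt => /predU1P[->//|xy]; rewrite /toggle_down.
have := mual (y + 1); have := mube (y + 1).
have := almu x; have := bemu x.
have xy1 : x + 1 <= y by lia.
have := ald _ _ xy1; have := bed _ _ xy1.
by lia.
Qed.

(** The summand is [g (x - 1)] plus a term at [x], where [g], the minimum minus [mu], is periodic.
    Hence [g (x - 1)] may be replaced by [g x] under the sum, and minimum plus maximum equals
    [al + be]. *)
Lemma toggle_up_size mu : cylpars mu ->
  \sum_(i < k) (toggle_up al be mu i%:Z - be i%:Z) =
  \sum_(i < k) (al i%:Z - mu i%:Z).
Proof.
move=> [_ muk]; case: alP beP => [_ alk] [_ bek].
pose g x := Num.min (al x) (be x) - mu x.
transitivity (\sum_(i < k) (g (i%:Z - 1) + (Num.max (al i%:Z) (be i%:Z) - be i%:Z))).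
  by apply: eq_bigr => i _; rewrite /toggle_up /g; lia.
rewrite big_split /= sum_pred_shift; last first.
  have := muk (-1); have := alk (-1); have := bek (-1).
  by rewrite (_ : -1 + k%:Z = k%:Z - 1) /g; lia.
by rewrite -big_split /=; apply: eq_bigr => i _; rewrite /g; lia.
Qed.

Lemma toggle_down_size lam : cylpars lam ->
  \sum_(i < k) (al i%:Z - toggle_down al be lam i%:Z) =
  \sum_(i < k) (lam i%:Z - be i%:Z).
Proof.
move=> [_ muk]; case: alP beP => [_ alk] [_ bek].
pose g x := lam x - Num.max (al x) (be x).
transitivity (\sum_(i < k) (g (i%:Z + 1) + (al i%:Z - Num.min (al i%:Z) (be i%:Z)))).
  by apply: eq_bigr => i _; rewrite /toggle_down /g; lia.
rewrite big_split /= sum_succ_shift; last first.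
  have := muk 0; have := alk 0; have := bek 0.
  by rewrite (_ : 0 + k%:Z = k%:Z) /g; lia.
by rewrite -big_split /=; apply: eq_bigr => i _; rewrite /g; lia.
Qed.

End Toggle.

Lemma toggle_up_hstrip a al be mu : cylpars al -> cylpars be -> cylpars mu ->
  hstrip a mu al -> subpar mu be -> (forall x : int, be (x + 1) <= mu x) ->
  hstrip a be (toggle_up al be mu).
Proof.
move=> alP beP muP [mual almu sz] mube bemu; split.
- move=> x; rewrite /toggle_up.
  by have := mual (x - 1); have := mube (x - 1); lia.
- move=> x; rewrite /toggle_up addrK.
  by have := almu x; have := bemu x; lia.
- by rewrite toggle_up_size.
Qed.

Lemma toggle_down_hstrip a al be lam : cylpars al -> cylpars be -> cylpars lam ->
  hstrip a be lam -> subpar al lam -> (forall x : int, lam (x + 1) <= al x) ->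
  hstrip a (toggle_down al be lam) al.
Proof.
move=> alP beP lamP [belam lambe sz] allam lamal; split.
- move=> x; rewrite /toggle_down.
  by have := allam (x + 1); have := belam (x + 1); lia.
- move=> x; rewrite /toggle_down.
  by have := lamal x; have := lambe x; lia.
- by rewrite toggle_down_size.
Qed.

Lemma toggle_upC al be : toggle_up al be = toggle_up be al.
Proof.
by apply/funext => mu; apply/funext => x; rewrite /toggle_up minC maxC.
Qed.

Lemma toggle_downC al be : toggle_down al be = toggle_down be al.
Proof.
by apply/funext => mu; apply/funext => x; rewrite /toggle_down minC maxC.
Qed.

(** The size [a] passes from the strip below [al] to the strip above [be], and [b] from below [be]
    to above [al], as in the two orders of the matrix product. *)
Lemma toggle_bij a b al be : cylpars al -> cylpars be ->
  set_bij [set mu | [/\ cylpars mu, hstrip a mu al & hstrip b mu be]]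
          [set lam | [/\ cylpars lam, hstrip b al lam & hstrip a be lam]]
          (toggle_up al be).
Proof.
move=> alP beP; split.
- move=> mu [muP hal hbe]; have [? ? _] := hal; have [? ? _] := hbe; split.
  + exact: toggle_up_cylpar.
  (* The rule is symmetric in [al] and [be], so the same lemma gives the other strip. *)
  + by rewrite toggle_upC; exact: toggle_up_hstrip.
  + exact: toggle_up_hstrip.
- by move=> mu mu' _ _; exact: (can_inj (toggle_upK al be)).
- move=> lam [lamP hal hbe]; have [? ? _] := hal; have [? ? _] := hbe.
  exists (toggle_down al be lam); last exact: toggle_downK.
  split.
  + exact: toggle_down_cylpar.
  + exact: toggle_down_hstrip.
  + by rewrite toggle_downC; exact: toggle_down_hstrip.
Qed.

(** * The matrices of horizontal strips and their commutation *)

Context {R : realType}.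

Definition hstrip_kernel (m : nat) (mu lam : int -> int) : \bar R :=
  if `[< hstrip m mu lam >] then 1%E else 0%E.

Lemma hstrip_kernel_ge0 m : kge0 (hstrip_kernel m).
Proof. by move=> mu lam; rewrite /hstrip_kernel; case: ifP. Qed.

(** The ends of both strips are functions of [nu], so that one statement covers both orders of the
    product: [nu] below the fixed partitions, or above them. *)
Lemma esum_hstrip_kernel (a b : nat) (mu mu' lam lam' : (int -> int) -> int -> int) :
  (\esum_(nu in cylpars)
     (hstrip_kernel a (mu nu) (lam nu) * hstrip_kernel b (mu' nu) (lam' nu)) =
   \esum_(nu in [set nu | [/\ cylpars nu, hstrip a (mu nu) (lam nu) &
                              hstrip b (mu' nu) (lam' nu)]]) 1)%E.
Proof.
rewrite esum_mkcond [RHS]esum_mkcond; apply: eq_esum => nu _.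
have -> : (nu \in [set nu | [/\ cylpars nu, hstrip a (mu nu) (lam nu) &
    hstrip b (mu' nu) (lam' nu)]]) =
    [&& nu \in cylpars, `[< hstrip a (mu nu) (lam nu) >]
      & `[< hstrip b (mu' nu) (lam' nu) >]].
  apply/idP/and3P; rewrite !in_setE => -[nuP H1 H2].
    by split=> //; apply/asboolP.
  by split=> //; apply/asboolP.
rewrite /hstrip_kernel; case: ifP => //= _.
by case: ifP; case: ifP; rewrite ?mule1 ?mule0 ?mul0e.
Qed.

Lemma hstrip_kernel_comm a b :
  kcomm cylpars (ktr (hstrip_kernel a)) (hstrip_kernel b).
Proof.
move=> al be alP beP; rewrite /kmul /ktr.
rewrite (esum_hstrip_kernel a b id id (fun=> al) (fun=> be)).
rewrite (esum_hstrip_kernel b a (fun=> al) (fun=> be) id id).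
exact/esym/reindex_esum/toggle_bij.
Qed.

(* mu is recovered from lam and the differences lam_i - mu_i on one period,
   each of which lies between 0 and m. *)
Lemma colfin_hstrip_kernel m : colfin cylpars (hstrip_kernel m).
Proof.
move=> lam lamP; split; last by move=> mu _; rewrite /hstrip_kernel; case: ifP.
pose rebuild (f : {ffun 'I_k -> 'I_m.+1}) (x : int) : int :=
  lam x - (f (Ordinal (ltn_pmod `|(x %% k)%Z| k_gt0)) : nat)%:Z.
apply: (@sub_finite_set _ _ (rebuild @` setT)); last first.
  by apply: finite_image; exact: finite_finset.
move=> mu [muP /=]; rewrite /hstrip_kernel; case: ifPn => [|_]; last by rewrite eqxx.
move=> /asboolP[mulam _ sz] _.
have le_m (i : 'I_k) : (`|lam i%:Z - mu i%:Z| < m.+1)%N.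
  move: sz; rewrite (bigD1 i) //=; set S := (X in _ + X = _).
  have : 0 <= S.
    by apply: sumr_ge0 => j _; rewrite subr_ge0.
  by have := mulam i%:Z; lia.
exists [ffun i => Ordinal (le_m i)] => //.
apply/funext => x; rewrite /rebuild ffunE /=.
have := ltz_modk x; have := mulam (x %% k)%Z.
rewrite (cylpar_mod x lamP) (cylpar_mod x muP) => le1 x_lt.
rewrite modn_small; last by lia.
by rewrite (_ : (`|(x %% k)%Z|%N)%:Z = (x %% k)%Z); lia.
Qed.

End HorizontalStrips.

Arguments cylpars n k : clear implicits.
Arguments hstrip k m mu lam : clear implicits.
Arguments hstrip_kernel k {R} m mu lam.

(** * Tableaux as chains of horizontal strips *)

(** A predicate closed downwards on an initial segment is determined by its first failure. This
    yields the length of the run of least letters in a row. *)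
Lemma find_downclosed (P : pred nat) (m t : nat) :
  (forall i j : nat, (i < j < m)%N -> P j -> P i) -> (t < m)%N ->
  P t = (t < find (predC P) (iota 0 m))%N.
Proof.
move=> Pdown tm; apply/idP/idP => [Pt|]; last first.
  move=> /[dup] tf /(before_find 0%N); rewrite nth_iota//= add0n.
  by move=> /negbFE.
rewrite ltnNge; apply/negP => ft; have fm := leq_ltn_trans ft tm.
have /(nth_find 0%N) : has (predC P) (iota 0 m) by rewrite has_find size_iota.
rewrite nth_iota//= add0n => /negP; apply.
move: ft; rewrite leq_eqVlt => /predU1P[->//|ft].
by apply: (Pdown _ t) => //; rewrite ft.
Qed.

Section Tableaux.
Context {n k : nat} (k_gt0 : (0 < k)%N) {d : Order.disp_t} {A : orderType d}.
Local Notation tableau := (int -> int -> option A).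
Local Notation cylpars := (cylpars n k).
Implicit Types (R S : tableau) (lam mu nu : int -> int) (a b : A) (p : A -> nat).

Lemma is_ssct_shift lam mu R x y j : is_ssct n k lam mu R ->
  R (x + j * k%:Z) (y - j * (n%:Z - k%:Z)) = R x y.
Proof.
move=> [RP _].
have step i : R (x + (i + 1) * k%:Z) (y - (i + 1) * (n%:Z - k%:Z)) =
    R (x + i * k%:Z) (y - i * (n%:Z - k%:Z)).
  by rewrite [LHS]RP; congr R; lia.
elim: j => [|j IH|j IH]; first by rewrite !mul0r addr0 subr0.
  by rewrite -addn1 PoszD step IH.
have := step (- (j.+1)%:Z); rewrite (_ : - (j.+1)%:Z + 1 = - j%:Z); last by lia.
by rewrite IH.
Qed.

Lemma in_skew_split lam nu mu x y : subpar mu nu -> subpar nu lam ->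
  in_skew lam mu x y = in_skew nu mu x y || in_skew lam nu x y.
Proof. by move=> /(_ x) ? /(_ x) ?; rewrite /in_skew; lia. Qed.

(** Each row of [lam/mu] is the row of [nu/mu] followed by that of [lam/nu]. *)
Lemma wt_split lam nu mu R a : subpar mu nu -> subpar nu lam ->
  wt k lam mu R a = (wt k nu mu R a + wt k lam nu R a)%N.
Proof.
move=> munu nulam; rewrite /wt -big_split /=; apply: eq_bigr => i _.
have := munu i%:Z; have := nulam i%:Z => le1 le2.
rewrite (_ : `|lam i%:Z - mu i%:Z|%N =
  (`|nu i%:Z - mu i%:Z| + `|lam i%:Z - nu i%:Z|)%N); last by lia.
rewrite big_split_ord /=; congr (_ + _)%N; apply: eq_bigr => t _.
rewrite (_ : mu i%:Z + 1 + (`|nu i%:Z - mu i%:Z| + t)%N%:Z =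
  nu i%:Z + 1 + t%:Z)//.
by lia.
Qed.

Lemma in_skew_ord lam mu (x : int) (t : 'I_(`|lam x - mu x|)) : subpar mu lam ->
  in_skew lam mu x (mu x + 1 + t%:Z).
Proof.
by move=> /(_ x) ?; have := ltn_ord t; rewrite /in_skew; lia.
Qed.

Lemma eq_wt lam mu R S a : subpar mu lam ->
  (forall x y, in_skew lam mu x y -> R x y = S x y) ->
  wt k lam mu R a = wt k lam mu S a.
Proof.
move=> mulam RS; apply: eq_bigr => i _; apply: eq_bigr => t _.
by rewrite RS// in_skew_ord.
Qed.

Lemma wt_const lam mu R a b : subpar mu lam ->
  (forall x y, in_skew lam mu x y -> R x y = Some b) ->
  (wt k lam mu R a)%:Z =
  if a == b then \sum_(i < k) (lam i%:Z - mu i%:Z) else 0.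
Proof.
move=> mulam Rb; rewrite /wt; case: eqP => [->|/eqP ab]; last first.
  rewrite big1// => i _; rewrite big1// => t _.
  by rewrite Rb ?in_skew_ord// (inj_eq Some_inj) eq_sym (negbTE ab).
rewrite (big_morph Posz PoszD (erefl _)); apply: eq_bigr => i _.
rewrite (eq_bigr (fun=> 1%N)) => [|t _]; last by rewrite Rb ?in_skew_ord// eqxx.
by rewrite sum1_card card_ord; have := mulam i%:Z; lia.
Qed.

Lemma wt_none lam mu R a : subpar mu lam ->
  (forall x y, in_skew lam mu x y -> R x y != Some a) -> wt k lam mu R a = 0%N.
Proof.
move=> mulam Ra; rewrite /wt big1// => i _; rewrite big1// => t _.
by rewrite (negbTE (Ra _ _ _))// in_skew_ord.
Qed.

Lemma wt_gt0 lam mu R x y a : cylpars lam -> cylpars mu ->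
  is_ssct n k lam mu R -> R x y = Some a -> (0 < wt k lam mu R a)%N.
Proof.
move=> lamP muP RT Rxy.
have [_ [dom _]] := RT.
have := ltz_modk k_gt0 x => x_lt.
pose i := `|(x %% k)%Z|%N; have iE : i%:Z = (x %% k)%Z by rewrite /i; lia.
have ik : (i < k)%N by lia.
(* [(i, y')] is the translate of [(x, y)] whose first coordinate lies in the period over which [wt]
   sums. *)
pose y' : int := y + (x %/ k)%Z * (n%:Z - k%:Z).
have Ri : R i%:Z y' = Some a.
  rewrite -Rxy -(is_ssct_shift i%:Z y' (x %/ k)%Z RT) iE addrC -divz_eq.
  by rewrite /y' addrK.
have := dom i%:Z y'; rewrite Ri /in_skew /= => /esym/andP[ylam ymu].
pose t := absz (y' - (mu i%:Z + 1))%R.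
have tlt : (t < absz (lam i%:Z - mu i%:Z)%R)%N by rewrite /t; lia.
rewrite /wt (bigD1 (Ordinal ik))//= (bigD1 (Ordinal tlt))//=.
rewrite (_ : mu i%:Z + 1 + t%:Z = y'); last by rewrite /t; lia.
by rewrite Ri eqxx.
Qed.

Lemma wt_support lam mu R :
  exists s : seq A, forall a, wt k lam mu R a != 0%N -> a \in s.
Proof.
exists (pmap id [seq R i%:Z (mu i%:Z + 1 + t%:Z) |
  i <- iota 0 k, t <- iota 0 `|lam i%:Z - mu i%:Z|]).
move=> a; rewrite /wt sum_nat_eq0 negb_forall => /existsP[i /=].
rewrite sum_nat_eq0 negb_forall => /existsP[t /=].
rewrite eqb0 negbK => /eqP Ra; rewrite mem_pmap map_id.
apply/allpairsPdep; exists (i : nat), (t : nat).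
by rewrite !mem_iota !ltn_ord Ra.
Qed.

(** * Removing the least letter of a tableau *)

Definition ssct_wt lam mu p : set tableau :=
  [set R | is_ssct n k lam mu R /\ (forall a, wt k lam mu R a = p a)].

Definition erase_letter a p : A -> nat := fun b => if b == a then 0%N else p b.

Definition add_letter a nu mu R : tableau :=
  fun x y => if in_skew nu mu x y then Some a else R x y.

Definition remove_letter a R : tableau :=
  fun x y => if R x y == Some a then None else R x y.

Lemma ssct_wt_letter lam mu p R x y a : cylpars lam -> cylpars mu ->
  ssct_wt lam mu p R -> R x y = Some a -> p a != 0%N.
Proof.
by move=> lamP muP [RT Rp] /(wt_gt0 lamP muP RT); rewrite Rp lt0n.
Qed.

Section Peel.
Context (a : A) (s : seq A) (p : A -> nat).
Hypothesis a_min : {in s, forall b, (a < b)%O}.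
Hypothesis p_supp : forall b, p b != 0%N -> b \in a :: s.

Lemma erase_letter_supp b : erase_letter a p b != 0%N -> b \in s.
Proof.
rewrite /erase_letter; case: (eqVneq b a) => // ba /p_supp.
by rewrite in_cons (negbTE ba).
Qed.

Lemma min_letter b : p b != 0%N -> (a <= b)%O.
Proof. by move=> /p_supp; rewrite in_cons => /predU1P[->//|/a_min/ltW]. Qed.

(** Every letter of [R] exceeds [a], so filling the inner strip with [a] keeps rows weak; columns
    stay strict because the strip is horizontal. *)
Lemma add_letter_ssct lam nu mu R : cylpars lam -> cylpars nu -> cylpars mu ->
  hstrip k (p a) mu nu -> subpar nu lam ->
  ssct_wt lam nu (erase_letter a p) R ->
  ssct_wt lam mu p (add_letter a nu mu R).
Proof.
move=> lamP nuP muP [munu numu sz] nulam RT.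
have mulam : subpar mu lam by move=> x; apply: le_trans (nulam x).
have gta x y b : R x y = Some b -> (a < b)%O.
  by move=> /(ssct_wt_letter lamP nuP RT)/erase_letter_supp/a_min.
have [[Rper [Rdom [Rrow Rcol]]] Rwt] := RT.
have domR x y b : R x y = Some b -> in_skew lam nu x y by rewrite -Rdom => ->.
split; last first.
  move=> b; rewrite (wt_split _ _ munu nulam); apply/eqP.
  rewrite -eqz_nat PoszD (@wt_const _ _ _ _ a)//; last first.
    by move=> x y xy; rewrite /add_letter xy.
  rewrite (@eq_wt _ _ _ R)//; last first.
    move=> x y; rewrite /add_letter /in_skew; case: ifP => //.
    by move=> /andP[? _] /andP[_ /negP].
  by rewrite Rwt /erase_letter; case: (eqVneq b a) => [->|_]; rewrite ?sz ?addr0 ?add0r.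
split; first by move=> x y; rewrite /add_letter in_skew_shift// -Rper.
split.
  move=> x y; rewrite /add_letter (in_skew_split x y munu nulam) -Rdom.
  by case: in_skew.
rewrite /add_letter; split.
  move=> x y1 y2 b c y12; case: ifP => [_ [<-]|sk1 R1].
    by case: ifP => [_ [<-]//|_ /gta/ltW].
  case: ifP => [sk2|_ R2]; last exact: Rrow y12 R1 R2.
  by have := domR _ _ _ R1; move: sk1 sk2; rewrite /in_skew; lia.
move=> x1 x2 y b c x12; case: ifP => [sk1 [<-]|sk1 R1].
  case: ifP => [sk2|_ /gta//].
  (* Two boxes of the strip with the same [y] would give
     [y <= nu x2 <= nu (x1 + 1) <= mu x1 < y]. *)
  have [nud _] := nuP; have [mud _] := muP.
  have x12' : x1 + 1 <= x2 by lia.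
  have := numu x1; have := nud _ _ x12'.
  by move: sk1 sk2; rewrite /in_skew; lia.
case: ifP => [sk2|_ R2]; last exact: Rcol x12 R1 R2.
have [nud _] := nuP; have := nud _ _ (ltW x12).
by have := domR _ _ _ R1; move: sk1 sk2; rewrite /in_skew; lia.
Qed.

Lemma remove_letter_ssct lam nu mu R : cylpars lam -> cylpars nu -> cylpars mu ->
  subpar mu nu -> subpar nu lam ->
  (forall x y, (R x y == Some a) = in_skew nu mu x y) ->
  ssct_wt lam mu p R -> hstrip k (p a) mu nu /\
  ssct_wt lam nu (erase_letter a p) (remove_letter a R).
Proof.
move=> lamP nuP muP munu nulam Ra RT.
have lea x y b : R x y = Some b -> (a <= b)%O.
  by move=> /(ssct_wt_letter lamP muP RT)/min_letter.
have [[Rper [Rdom [Rrow Rcol]]] Rwt] := RT.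
have wta b : (wt k nu mu R b)%:Z =
    if b == a then \sum_(i < k) (nu i%:Z - mu i%:Z) else 0.
  by apply: wt_const => // x y; rewrite -Ra => /eqP.
have nota x y : in_skew lam nu x y -> R x y != Some a.
  by rewrite Ra /in_skew; lia.
have wtR : wt k lam nu R a = 0%N by exact: wt_none.
split.
  split => //; last by rewrite -Rwt (wt_split _ _ munu nulam) wtR addn0 wta eqxx.
  (* Otherwise the box at [(x + 1, nu (x + 1))] carries [a] while [(x, nu (x + 1))] is also a box;
     column strictness would put there a letter below the least one. *)
  move=> x; rewrite leNgt; apply/negP => munux.
  have [mud _] := muP; have [lamd _] := lamP.
  have xx1 : x <= x + 1 by lia.
  have := mud _ _ xx1; have := lamd _ _ xx1; have := nulam (x + 1) => h1 h2 h3.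
  have /eqP Ra1 : R (x + 1) (nu (x + 1)) == Some a.
    by rewrite Ra /in_skew; lia.
  have : isSome (R x (nu (x + 1))) by rewrite Rdom /in_skew; lia.
  case E : (R x _) => [b|//] _.
  have xltx1 : x < x + 1 by lia.
  by have := Rcol _ _ _ _ _ xltx1 E Ra1; rewrite ltNge (lea _ _ _ E).
split; last first.
  move=> b; rewrite /erase_letter; case: (eqVneq b a) => [->|ba].
    apply: wt_none => // x y _; rewrite /remove_letter.
    by case: ifP => // /negbT.
  rewrite -Rwt (wt_split _ _ munu nulam).
  have -> : wt k nu mu R b = 0%N by apply/eqP; rewrite -eqz_nat wta (negbTE ba).
  apply: eq_wt => // x y /nota; rewrite /remove_letter.
  by move=> /negbTE ->.
rewrite /remove_letter; split; first by move=> x y; rewrite -Rper.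
split.
  move=> x y; rewrite Ra; have := Rdom x y.
  rewrite (in_skew_split x y munu nulam); case: ifP => [|_ -> //].
  by rewrite /in_skew /=; lia.
split.
  move=> x y1 y2 b c y12; case: ifP => // _ R1; case: ifP => // _ R2.
  exact: Rrow y12 R1 R2.
move=> x1 x2 y b c x12; case: ifP => // _ R1; case: ifP => // _ R2.
exact: Rcol x12 R1 R2.
Qed.

(* Rows increase weakly, so the boxes holding the least letter form an initial
   segment of each row. *)
Lemma min_letter_shape lam mu R : cylpars lam -> cylpars mu -> subpar mu lam ->
  ssct_wt lam mu p R ->
  exists nu, [/\ cylpars nu, subpar mu nu, subpar nu lam &
    forall x y, (R x y == Some a) = in_skew nu mu x y].
Proof.
move=> lamP muP mulam RT.
have lea x y b : R x y = Some b -> (a <= b)%O.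
  by move=> /(ssct_wt_letter lamP muP RT)/min_letter.
have [[Rper [Rdom [Rrow Rcol]]] Rwt] := RT.
pose len x := find (predC (fun t : nat => R x (mu x + 1 + t%:Z) == Some a))
  (iota 0 `|lam x - mu x|).
pose nu x := mu x + (len x)%:Z.
have munu : subpar mu nu by move=> x; rewrite /nu; lia.
have nulam : subpar nu lam.
  move=> x; have : (len x <= `|lam x - mu x|)%N.
    by rewrite -[leqRHS](size_iota 0); exact: find_size.
  by have := mulam x; rewrite /nu; lia.
have Ra x y : (R x y == Some a) = in_skew nu mu x y.
  have [xy|xy] := boolP (in_skew lam mu x y); last first.
    have -> : in_skew nu mu x y = false.
      by have := nulam x; move: xy; rewrite /in_skew; lia.
    by move: xy; rewrite -Rdom; case: (R x y).
  pose t := absz (y - (mu x + 1))%R.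
  have yE : y = mu x + 1 + t%:Z by move: xy; rewrite /t /in_skew; lia.
  have tlt : (t < `|lam x - mu x|)%N by move: xy; rewrite /t /in_skew; lia.
  rewrite {1}yE.
  rewrite (@find_downclosed (fun t : nat => R x (mu x + 1 + t%:Z) == Some a) _ _ _ tlt).
    by rewrite -/(len x) /in_skew /nu; lia.
  move=> i j /andP[ij jlt] /eqP Rj.
  have ij' : mu x + 1 + i%:Z < mu x + 1 + j%:Z by lia.
  have : isSome (R x (mu x + 1 + i%:Z)).
    by rewrite Rdom /in_skew; have := mulam x; lia.
  case E : (R x _) => [b|//] _; apply/eqP; congr Some; apply/eqP.
  by rewrite eq_le (Rrow _ _ _ _ _ ij' E Rj) (lea _ _ _ E).
exists nu; split => //; split; last first.
  move=> x; have [_ muk] := muP; have [_ lamk] := lamP.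
  have lenE : len (x + k%:Z) = len x.
    rewrite /len; have -> : lam (x + k%:Z) - mu (x + k%:Z) = lam x - mu x.
      by rewrite (muk x) (lamk x); lia.
    apply: eq_find => t /=; congr (~~ (_ == _)).
    by rewrite [LHS]Rper; congr R; rewrite ?addrK// (muk x); lia.
  by rewrite /nu lenE (muk x); lia.
move=> x x'; rewrite le_eqVlt => /predU1P[->//|xx'].
(* In fact [nu x' <= mu x]: if not, the box [(x, nu x')] would carry a letter smaller than the [a]
   at [(x', nu x')]. *)
apply: (le_trans _ (munu x)); rewrite leNgt; apply/negP => munux.
have [mud _] := muP; have [lamd _] := lamP.
have := mud _ _ (ltW xx'); have := lamd _ _ (ltW xx').
have := nulam x' => h1 h2 h3.
have /eqP Ra1 : R x' (nu x') == Some a by rewrite Ra /in_skew; lia.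
have : isSome (R x (nu x')) by rewrite Rdom /in_skew; lia.
case E : (R x _) => [b|//] _.
by have := Rcol _ _ _ _ _ xx' E Ra1; rewrite ltNge (lea _ _ _ E).
Qed.

Lemma in_skew_inj nu nu' mu : subpar mu nu -> subpar mu nu' ->
  in_skew nu mu =2 in_skew nu' mu -> nu = nu'.
Proof.
move=> h h' e; apply/funext => x; have := h x; have := h' x.
by have := e x (nu x); have := e x (nu' x); rewrite /in_skew; lia.
Qed.

(** Injectivity holds because [R] avoids [a], so the boxes labelled [a] recover [nu]. Surjectivity
    removes these boxes and puts them back. *)
Lemma add_letter_bij lam mu : cylpars lam -> cylpars mu -> subpar mu lam ->
  set_bij ([set nu | [/\ cylpars nu, hstrip k (p a) mu nu & subpar nu lam]] `*``
             (fun nu => ssct_wt lam nu (erase_letter a p)))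
          (ssct_wt lam mu p) (fun z => add_letter a z.1 mu z.2).
Proof.
move=> lamP muP mulam; split.
- by move=> [nu R] [/= [nuP h nulam] RT]; exact: add_letter_ssct.
- have noa nu R x y : cylpars nu -> ssct_wt lam nu (erase_letter a p) R ->
      (R x y == Some a) = false.
    move=> nuP RT; apply/eqP => /(ssct_wt_letter lamP nuP RT).
    by rewrite /erase_letter eqxx.
  move=> [nu R] [nu' R']; rewrite !in_setE /=.
  move=> [/= [nuP [munu _ _] nulam] RT] [/= [nuP' [munu' _ _] nulam'] RT'] eqR.
  have eqR' x y := congr1 (fun f : tableau => f x y) eqR.
  have numu : nu = nu'.
    apply: (in_skew_inj munu munu') => x y.
    have := congr1 (eq_op^~ (Some a)) (eqR' x y); rewrite /add_letter.
    move: (noa _ _ x y nuP RT) (noa _ _ x y nuP' RT') => noR noR'.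
    by case: ifP; case: ifP; rewrite ?eqxx ?noR ?noR'.
  subst nu'; congr pair; apply/funext => x; apply/funext => y.
  have := eqR' x y; rewrite /add_letter; case: ifP => // sk _.
  have [[_ [dom _]] _] := RT; have [[_ [dom' _]] _] := RT'.
  have skF : in_skew lam nu x y = false by move: sk; rewrite /in_skew; lia.
  by move: (dom x y) (dom' x y); rewrite skF; case: (R x y); case: (R' x y).
- move=> R RT; have [nu [nuP munu nulam Ra]] := min_letter_shape lamP muP mulam RT.
  have [h RT'] := remove_letter_ssct lamP nuP muP munu nulam Ra RT.
  exists (nu, remove_letter a R) => //=.
  apply/funext => x; apply/funext => y; rewrite /add_letter /remove_letter -Ra.
  by case: eqP.
Qed.

End Peel.

(** * Coefficients as entries of matrix products *)

Context {RR : realType}.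

Lemma scoef_peel a (s : seq A) p lam mu : {in s, forall b, (a < b)%O} ->
  (forall b, p b != 0%N -> b \in a :: s) ->
  cylpars lam -> cylpars mu -> subpar mu lam ->
  (scoef RR n k lam mu p =
   \esum_(nu in [set nu | [/\ cylpars nu, hstrip k (p a) mu nu & subpar nu lam]])
     scoef RR n k lam nu (erase_letter a p))%E.
Proof.
move=> a_min p_supp lamP muP mulam; rewrite /scoef.
rewrite esum_esum//; apply: reindex_esum.
exact: add_letter_bij a_min p_supp _ _ lamP muP mulam.
Qed.

Lemma scoef_empty lam mu p : cylpars lam -> cylpars mu -> subpar mu lam ->
  (forall a, p a = 0%N) -> scoef RR n k lam mu p = kdelta mu lam.
Proof.
move=> lamP muP mulam p0; rewrite /kdelta; case: eqP => [<-|mulamN]; last first.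
  rewrite /scoef [X in esum X](_ : _ = set0) ?esum_set0//.
  apply/seteqP; split => // R RT; apply: mulamN; apply/funext => x.
  apply/eqP; rewrite eq_le mulam leNgt; apply/negP => mulamx.
  have [[_ [Rdom _]] _] := RT.
  have : isSome (R x (lam x)) by rewrite Rdom /in_skew; lia.
  case E : (R x _) => [a|//] _.
  by have := ssct_wt_letter lamP muP RT E; rewrite p0 eqxx.
rewrite /scoef [X in esum X](_ : _ = [set (fun _ _ => None)]) ?esum_set1//.
apply/seteqP; split => R /=.
  move=> [[_ [Rdom _]] _]; apply/funext => x; apply/funext => y.
  by move: (Rdom x y); rewrite /in_skew andbN; case: (R x y).
move=> ->; split; last by move=> a; rewrite p0; exact: wt_none.
by split => //; split => // x y; rewrite /in_skew andbN.
Qed.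

(** The guard matters: if [lam] lies strictly below [mu] everywhere, the nowhere defined map counts
    as a tableau of weight zero, whereas the matrix entry vanishes. *)
Lemma scoef_kprod (s : seq A) p lam mu : sorted <%O s ->
  (forall a, p a != 0%N -> a \in s) -> cylpars lam -> cylpars mu ->
  (if `[< subpar mu lam >] then scoef RR n k lam mu p else 0%E) =
  kprod cylpars (hstrip_kernel k) [seq p a | a <- s] mu lam.
Proof.
elim: s p mu => [|a s IH] p mu.
  move=> _ p0 lamP muP /=; case: asboolP => [mulam|mulamN].
    apply: scoef_empty => // a; apply/eqP; case: eqP => // /eqP.
    by move=> /p0; rewrite in_nil.
  rewrite /kdelta; case: eqP => // mulam.
  by case: mulamN => x; rewrite mulam.
rewrite /= (path_sortedE lt_trans) => /andP[/allP a_min s_sorted] p_supp lamP muP.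
(* The letters of [s] all exceed [a], so erasing [a] leaves their exponents unchanged and the
   induction hypothesis applies. *)
have -> : [seq p b | b <- s] = [seq erase_letter a p b | b <- s].
  apply/eq_in_map => b /a_min ab; rewrite /erase_letter.
  by rewrite gt_eqF.
transitivity (\esum_(nu in cylpars) (hstrip_kernel (R := RR) k (p a) mu nu *
    (if `[< subpar nu lam >] then scoef RR n k lam nu (erase_letter a p)
     else 0)))%E; last first.
  apply: eq_esum => nu nuP; congr (_ * _)%E; apply: IH => //.
  exact: erase_letter_supp p_supp.
case: asboolP => [mulam|mulamN]; last first.
  rewrite esum1// => nu nuP; rewrite /hstrip_kernel.
  case: asboolP => [[munu _ _]|_]; last by rewrite mul0e.
  case: asboolP => [nulam|_]; last by rewrite mule0.
  by case: mulamN => x; exact: le_trans (nulam x).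
rewrite (scoef_peel a_min p_supp lamP muP mulam).
rewrite [LHS]esum_mkcond [RHS]esum_mkcond; apply: eq_esum => nu _.
rewrite /hstrip_kernel; case: ifPn => [|nuN].
  rewrite in_setE => -[nuP h nulam]; rewrite mem_set//.
  by do 2!rewrite asboolT//; rewrite mul1e.
case: ifP => //; rewrite in_setE => nuP.
case: asboolP => [h|_]; last by rewrite mul0e.
case: asboolP => [nulam|_]; last by rewrite mule0.
by move: nuN; rewrite mem_set.
Qed.

(** A tableau has finitely many boxes modulo translation, hence uses finitely many letters. *)
Lemma scoef_infinite_support lam mu p :
  ~ (exists s : seq A, forall a, p a != 0%N -> a \in s) ->
  scoef RR n k lam mu p = 0%E.
Proof.
move=> pN; rewrite /scoef [X in esum X](_ : _ = set0) ?esum_set0//.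
apply/seteqP; split => // R [_ Rp]; apply: pN.
have [s sP] := wt_support lam mu R; exists s => a.
by rewrite -Rp; exact: sP.
Qed.

End Tableaux.

(** * The Cauchy identity *)

Lemma sorted_support {d : Order.disp_t} {A : orderType d} (p : A -> nat) :
  (exists s : seq A, forall a, p a != 0%N -> a \in s) ->
  exists2 s : seq A, sorted <%O s & forall a, p a != 0%N -> a \in s.
Proof.
move=> [s ps]; exists (sort <=%O (undup s)).
  by rewrite sort_lt_sorted undup_uniq.
by move=> a /ps; rewrite mem_sort mem_undup.
Qed.

(** The shapes are functions of [nu] so as to serve both sides of the identity; the inclusions
    restricting the left sum become vanishing matrix entries on the right. *)
Lemma esum_scoef_mul (RR : realType) (d : Order.disp_t) (A : orderType d)
    (n k : nat) (k_gt0 : (0 < k)%N) (s t : seq A) (p q : A -> nat)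
    (mu mu' lam lam' : (int -> int) -> int -> int) :
  sorted <%O s -> sorted <%O t ->
  (forall a, p a != 0%N -> a \in s) -> (forall a, q a != 0%N -> a \in t) ->
  (forall nu, cylpar n k nu -> [/\ cylpar n k (mu nu), cylpar n k (mu' nu),
     cylpar n k (lam nu) & cylpar n k (lam' nu)]) ->
  (\esum_(nu in [set nu | cylpar n k nu /\ subpar (mu nu) (lam nu) /\
                          subpar (mu' nu) (lam' nu)])
     (scoef RR n k (lam nu) (mu nu) p * scoef RR n k (lam' nu) (mu' nu) q) =
   \esum_(nu in cylpars n k)
     (kprod (cylpars n k) (hstrip_kernel k) [seq p a | a <- s] (mu nu) (lam nu) *
      kprod (cylpars n k) (hstrip_kernel k) [seq q a | a <- t] (mu' nu) (lam' nu)))%E.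
Proof.
move=> s_sorted t_sorted ps qt cyl.
rewrite [LHS]esum_mkcond [RHS]esum_mkcond; apply: eq_esum => nu _.
case: (boolP (nu \in cylpars n k)); last first.
  case: ifP => //; rewrite in_setE => -[nuP _].
  by rewrite mem_set.
rewrite in_setE => nuP; have [? ? ? ?] := cyl _ nuP.
rewrite -!scoef_kprod//; case: ifPn => [|nuN].
  by rewrite in_setE => -[_ [h h']]; do 2!rewrite asboolT//.
case: asboolP => [h|_]; last by rewrite mul0e.
case: asboolP => [h'|_]; last by rewrite mule0.
by move: nuN; rewrite mem_set.
Qed.

(** The power series are compared through the coefficient of each monomial given by [p] and [q];
    finiteness ensures that this coefficient is a genuine number. *)
Theorem mainTheorem2 (RR : realType) (d : Order.disp_t) (A : orderType d)
  (n k : nat) (hk : (1 <= k)%N) (hkn : (k < n)%N)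
  (alpha beta : int -> int) (halpha : cylpar n k alpha) (hbeta : cylpar n k beta)
  (p q : A -> nat) :
  let LHS := \esum_(mu in [set mu : int -> int |
                 cylpar n k mu /\ subpar mu alpha /\ subpar mu beta])
               (scoef RR n k alpha mu p * scoef RR n k beta mu q)%E in
  let RHS := \esum_(lam in [set lam : int -> int |
                 cylpar n k lam /\ subpar alpha lam /\ subpar beta lam])
               (scoef RR n k lam beta p * scoef RR n k lam alpha q)%E in
  LHS = RHS /\ LHS \is a fin_num.
Proof.
move=> LHS RHS.
(* If [p] or [q] has infinite support, every term on both sides is zero. *)
have [/sorted_support[s s_sorted ps]|pN] :=
  pselect (exists s : seq A, forall a, p a != 0%N -> a \in s); last first.
  by rewrite /LHS /RHS !esum1// => nu _; rewrite scoef_infinite_support// mul0e.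
have [/sorted_support[t t_sorted qt]|qN] :=
  pselect (exists s : seq A, forall a, q a != 0%N -> a \in s); last first.
  rewrite /LHS /RHS !esum1// => nu _.
    by rewrite [X in (_ * X)%E]scoef_infinite_support// mule0.
  by rewrite [X in (_ * X)%E]scoef_infinite_support// mule0.
pose P := kprod (cylpars n k) (hstrip_kernel (R := RR) k) [seq p a | a <- s].
pose Q := kprod (cylpars n k) (hstrip_kernel (R := RR) k) [seq q a | a <- t].
have U0 := @hstrip_kernel_ge0 k RR.
have P0 : kge0 P by exact: kprod_ge0.
have Q0 : kge0 Q by exact: kprod_ge0.
have Uf := @colfin_hstrip_kernel n k hk RR.
have LHSE : LHS = kmul (cylpars n k) (ktr P) Q alpha beta.
  exact: (@esum_scoef_mul _ _ _ _ _ hk s t p q id id (fun=> alpha) (fun=> beta)).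
have RHSE : RHS = kmul (cylpars n k) Q (ktr P) alpha beta.
  (* In the product [Q] times [ktr P] the factor for [q] comes first, so the two factors of each
     term are swapped. *)
  transitivity (\esum_(nu in cylpars n k) (P beta nu * Q alpha nu))%E; last first.
    by apply: eq_esum => nu _; rewrite muleC.
  rewrite -(@esum_scoef_mul _ _ _ _ _ hk s t p q (fun=> beta) (fun=> alpha) id id)//.
  congr esum; apply/seteqP.
  by split=> nu [nuP [h h']].
split; last by rewrite LHSE kmul_tr_fin//; exact: colfin_prod.
rewrite LHSE RHSE; apply: kcomm_prod_tr => // i j.
exact: hstrip_kernel_comm.
Qed.
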